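(* $$\zeta(2,1)=\sum_{n=1}^\infty\frac{H_{n,1}}{(n+1)^2}=\zeta(3),\qquad \sum_{n=1}^\infty\frac{(-1)^nH_{n,1}}{(n+1)^2}=-\frac18\,\zeta(3).$$
   Context: $H_{n,1}=\sum_{m=1}^n\frac1m$; $\zeta(s)=\sum_{n\ge1}n^{-s}$ is the Riemann zeta function; for integers $k\ge 2$, $m\ge1$ the double zeta value is $\zeta(k,m)=\sum_{n_1>n_2\ge1}\frac{1}{n_1^k n_2^m}$. *)

(* Defs.v *)
From HB Require Import structures.
From mathcomp Require Import all_boot all_order all_algebra.
From mathcomp Require Import all_classical all_reals all_analysis.
Set Implicit Arguments.
Unset Strict Implicit.
Unset Printing Implicit Defensive.
Import Order.TTheory GRing.Theory Num.Theory.
Import numFieldNormedType.Exports.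
Local Open Scope classical_set_scope.
Local Open Scope ring_scope.

Definition harmonic_number (R : realType) (n : nat) : R :=
  \sum_(1 <= m < n.+1) m%:R^-1.

(* The Dirichlet series, at real arguments; it represents the Riemann zeta
   function for s > 1. *)
Definition zeta (R : realType) (s : R) : R :=
  limn (fun N => \sum_(1 <= n < N) n%:R `^ (- s)).

(* The terms are nonnegative, so the sum over the index set makes sense in
   \bar R whether or not it is finite. *)
Definition double_zeta (R : realType) (k m : nat) : \bar R :=
  \esum_(p in [set p : nat * nat | (1 <= p.2 < p.1)%N])
    ((p.1%:R ^+ k * p.2%:R ^+ m)^-1)%:E.

(* Main.v *)
Require Import Defs.
From HB Require Import structures.
From mathcomp Require Import all_boot all_order all_algebra.
From mathcomp Require Import all_classical all_reals all_analysis.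
From mathcomp Require Import ring lra zify.
Import Order.TTheory GRing.Theory Num.Theory.
Import numFieldNormedType.Exports.
Local Open Scope classical_set_scope.
Local Open Scope ring_scope.

(* Write Z(w) for the sum of w(m,n)/(m^2 n) over m > n >= 1, where w is a 0/1
   weight, and T(w) for the sum of w(n,k)/(n k (n+k)) over n, k >= 1.  Partial
   fractions give T(w) = Z(w(n,m-n)) + Z(w(m-n,n)), while telescoping over k
   gives, when w depends on n only, T(w) = Z(w(m)) + sum_n w(n)/n^3.
   For w = 1 the two agree to 2 Z(1) = Z(1) + zeta(3), and Z(1) is finite.
   For w(n) = [n even], the parity identity
     [n even] + [m-n even] + [m even] = 1 + 2 [m, n even]
   and the homogeneity Z([m, n even]) = Z(1)/8 turn the comparison into
   Z([m even]) + zeta(3)/8 = (5/4) zeta(3) - Z([m even]).  The alternating sum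
   is Z(1) - 2 Z([m even]).  Weights are kept nonnegative so that all double
   sums can be rearranged freely in the extended reals. *)

(** * Nonnegative sums in the extended reals *)

Lemma ge0_esumZl (R : realType) (T : choiceType) (I : set T) (c : R)
    (a : T -> \bar R) :
  0 <= c -> (forall i, I i -> (0 <= a i)%E) ->
  (\esum_(i in I) (c%:E * a i) = c%:E * \esum_(i in I) a i)%E.
Proof.
have le_Zl (d : R) (b : T -> \bar R) : 0 <= d ->
    (forall i, I i -> (0 <= b i)%E) ->
    (\esum_(i in I) (d%:E * b i) <= d%:E * \esum_(i in I) b i)%E.
  move=> d0 b0; apply: ge_ereal_sup => _ [X [finX XI] <-].
  rewrite fsbig_finite//= big_seq -ge0_sume_distrr; last first.
    by move=> i; rewrite in_fset_set// inE => /XI/b0.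
  rewrite lee_wpmul2l ?lee_fin// -big_seq esum_ge//.
  by exists X; rewrite ?fsbig_finite.
rewrite le_eqVlt => /predU1P[<- a0|c0 a0].
  by rewrite mul0e esum1// => i _; rewrite mul0e.
apply/eqP; rewrite eq_le le_Zl ?(ltW c0)//=.
(* The converse inequality is [le_Zl] for the factor 1/c and the family c * a. *)
rewrite -lee_pdivlMl//.
apply: le_trans (le_Zl _ _ _ _); last 2 first.
- by rewrite invr_ge0 ltW.
- by move=> i Ii; rewrite mule_ge0 ?a0// lee_fin ltW.
apply: le_esum => i _; rewrite muleA -EFinM mulVf ?mul1e//.
exact: lt0r_neq0.
Qed.

Lemma esum_gt0_nneseries (R : realType) (f : nat -> \bar R) :
  (forall n, (0 < n)%N -> (0 <= f n)%E) ->
  (\esum_(n in [set n | (0 < n)%N]) f n = \sum_(1 <= n <oo) f n)%E.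
Proof. by move=> f0; rewrite eseries_cond/= nneseries_esum. Qed.

Lemma cvg_sum_nneseries (R : realType) (u : nat -> R) (l : R) :
  (forall n, (0 < n)%N -> 0 <= u n) ->
  (\sum_(1 <= n <oo) (u n)%:E)%E = l%:E ->
  (fun N => \sum_(1 <= n < N) u n) @ \oo --> l.
Proof.
move=> u0 ul; have /cvg_ex[/= y] : cvgn (fun N => \sum_(1 <= n < N) (u n)%:E)%E.
  by apply: is_cvg_nneseries => n n0 _; rewrite lee_fin u0.
move=> /[dup] /(cvg_lim (@ereal_hausdorff R)).
rewrite ul => <- /fine_cvg; apply: cvg_trans; apply: near_eq_cvg.
by apply: nearW => N /=; rewrite sumEFin.
Qed.

(** * Weighted double sums over a triangle *)

Section double_sums.
Variable R : realType.
Implicit Types (u : nat -> bool) (w : nat -> nat -> bool).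

(** The exponent 1 is kept so that the terms match those of [double_zeta]. *)
Definition tri_sum w : \bar R :=
  \esum_(p in [set p : nat * nat | (1 <= p.2 < p.1)%N])
    ((w p.1 p.2)%:R * (p.1%:R ^+ 2 * p.2%:R ^+ 1)^-1)%:E.

Definition tornheim_sum w : \bar R :=
  \esum_(p in [set p : nat * nat | (0 < p.1)%N && (0 < p.2)%N])
    ((w p.1 p.2)%:R * (p.1%:R * p.2%:R * (p.1 + p.2)%:R)^-1)%:E.

Lemma double_zeta21E : double_zeta R 2 1 = tri_sum (fun _ _ => true).
Proof. by apply: eq_esum => p _; rewrite mul1r. Qed.

Lemma tri_sum_ge0 w : (0 <= tri_sum w)%E.
Proof. by apply: esum_ge0 => p _; rewrite lee_fin mulr_ge0. Qed.

Lemma tri_sumD w1 w2 w3 w4 :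
  (forall m n, (0 < n < m)%N -> w1 m n + w2 m n = w3 m n + w4 m n)%N ->
  (tri_sum w1 + tri_sum w2 = tri_sum w3 + tri_sum w4)%E.
Proof.
move=> ww; rewrite /tri_sum -!esumD; try by move=> *; rewrite lee_fin mulr_ge0.
by apply: eq_esum => -[m n] /= /ww e; rewrite -!EFinD -!mulrDl -!natrD e.
Qed.

Lemma tri_sum_rows u :
  tri_sum (fun m _ => u m) =
    (\esum_(m in [set m | (0 < m)%N])
       ((u m)%:R * ((\sum_(1 <= n < m) n%:R^-1) / m%:R ^+ 2))%:E)%E.
Proof.
transitivity (\esum_(m in [set m | (0 < m)%N])
  \esum_(n in [set n | n \in index_iota 1 m])
    ((u m)%:R * (m%:R ^+ 2 * n%:R ^+ 1)^-1 : R)%:E)%E; last first.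
  apply: eq_esum => m /= m0; rewrite esum_fset; last 2 first.
  - exact: finite_seq.
  - by move=> n _; rewrite lee_fin mulr_ge0.
  rewrite -fsbig_seq ?iota_uniq// sumEFin -mulr_sumr mulrC; congr (_%:E).
  rewrite mulrC; congr (_ * _); rewrite mulr_suml; apply: eq_bigr => n _.
  by rewrite invfM mulrC expr1.
rewrite esum_esum; last by move=> *; rewrite lee_fin mulr_ge0.
rewrite /tri_sum; congr (esum _ _); apply/seteqP; split=> -[m n] /=.
  by move=> /andP[n1 nm]; rewrite mem_index_iota n1 nm; split=> //; lia.
by rewrite mem_index_iota => -[].
Qed.

Lemma tri_sum_harmonic u :
  tri_sum (fun m _ => u m) =
    (\sum_(1 <= n <oo)
       ((u n.+1)%:R * (harmonic_number R n / n.+1%:R ^+ 2))%:E)%E.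
Proof.
rewrite tri_sum_rows esum_gt0_nneseries; last first.
  by move=> n _; rewrite lee_fin mulr_ge0// divr_ge0// sumr_ge0.
pose F m : \bar R :=
  ((u m)%:R * ((\sum_(1 <= n < m) n%:R^-1) / m%:R ^+ 2))%:E.
have F0 n : (0 <= F n)%E.
  by rewrite lee_fin mulr_ge0// divr_ge0// sumr_ge0.
(* The row m = 1 is empty; the others are reindexed by m = n + 1. *)
rewrite (@nneseries_split _ F 1 1)// big_nat1 /F big_geq//.
rewrite mul0r mulr0 add0e addn1 -(@nneseries_addn _ F 2)//.
rewrite -[RHS](@nneseries_addn _ (fun n => F n.+1) 1)//.
by apply: eq_eseriesr => i _; rewrite addn1 addn2.
Qed.

(** * Two evaluations of the Tornheim sum, and finiteness *)

(** With m = n + k, 1/(n k m) = 1/(m^2 n) + 1/(m^2 k); the two terms are reindexed by (m, n) and (m,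
    k). *)
Lemma tornheim_sum_partial_fractions w :
  tornheim_sum w =
    (tri_sum (fun m n => w n (m - n)%N) + tri_sum (fun m n => w (m - n)%N n))%E.
Proof.
pose P := [set p : nat * nat | (0 < p.1)%N && (0 < p.2)%N].
rewrite /tri_sum (reindex_esum P _ (fun p => (p.1 + p.2, p.1)%N)); last first.
  rewrite /P; split=> [[n k]/=|[n k] [n' k']/= _ _ []|[m n]/= mn]; [lia| |].
    by move=> /[swap] -> /addnI ->.
  by exists (n, m - n)%N => /=; [lia|congr (_, _); lia].
rewrite [X in (_ + X)%E](reindex_esum P _ (fun p => (p.1 + p.2, p.2)%N));
    last first.
  rewrite /P; split=> [[n k]/=|[n k] [n' k']/= _ _ []|[m n]/= mn]; [lia| |].
    by move=> /[swap] -> /addIn ->.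
  by exists (m - n, n)%N => /=; [lia|congr (_, _); lia].
rewrite -esumD; try by move=> *; rewrite lee_fin mulr_ge0.
apply: eq_esum => -[n k] /= /andP[n0 k0].
rewrite addKn addnK -EFinD -mulrDr natrD; congr (_ * _)%:E.
have : 0 < n%:R :> R by rewrite ltr0n.
have : 0 < k%:R :> R by rewrite ltr0n.
by move=> ? ?; field; rewrite !lt0r_neq0// addr_gt0.
Qed.

(** Each term is 1/k - 1/(n + k). On the right the number of terms does not depend on N, so the
    limit in N can be taken term by term. *)
Lemma sum_inv_telescope (n N : nat) :
  \sum_(k < N) n%:R / (k.+1%:R * (n + k.+1)%:R) =
    \sum_(j < n) (j.+1%:R^-1 - (N + j).+1%:R^-1) :> R.
Proof.
elim: N => [|N IH]; first by rewrite big_ord0 big1// => j _; rewrite subrr.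
rewrite big_ord_recr/= IH; apply/eqP; rewrite -subr_eq0 addrAC -sumrB.
(* The increment of the right-hand side from N to N + 1 telescopes in j. *)
rewrite (eq_bigr (fun j : 'I_n => (N + j.+1).+1%:R^-1 - (N + j).+1%:R^-1));
  last first.
  by move=> j _; rewrite addSnnS; ring.
rewrite -(big_mkord xpredT
  (fun j => (N + j.+1).+1%:R^-1 - (N + j).+1%:R^-1)) telescope_sumr//.
rewrite addn0 -addSn [(N.+1 + n)%N]addnC !natrD.
have : 0 < N.+1%:R :> R by rewrite ltr0n.
have : 0 <= n%:R :> R by [].
move: n%:R N.+1%:R => x y x0 y0; apply/eqP; field.
by rewrite !lt0r_neq0 ?ltr_wpDl.
Qed.

Lemma esum_inv_telescope (n : nat) :
  (\esum_(k in [set k | (0 < k)%N]) (n%:R / (k%:R * (n + k)%:R))%:E =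
    (\sum_(1 <= j < n.+1) j%:R^-1 : R)%:E)%E.
Proof.
rewrite esum_gt0_nneseries; last first.
  by move=> k _; rewrite lee_fin divr_ge0// mulr_ge0.
rewrite -(nneseries_addn 1); last by move=> k; rewrite lee_fin divr_ge0// mulr_ge0.
apply/cvg_lim => //.
rewrite (_ : (fun _ => _) = EFin \o
    (fun N => \sum_(j < n) (j.+1%:R^-1 - (N + j).+1%:R^-1))); last first.
  apply/funext => N /=; rewrite sumEFin -sum_inv_telescope big_mkord.
  by under eq_bigr do rewrite addn1.
apply: cvg_EFin; first exact: nearW.
rewrite big_add1 big_mkord; apply: cvg_big => [|j _]; first exact: add_continuous.
rewrite -[X in _ --> X]subr0; apply: cvgB; first exact: cvg_cst.
by rewrite (cvg_shiftn j (fun N => N.+1%:R^-1 : R)); exact: cvg_harmonic.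
Qed.

Lemma tornheim_sum_rows u :
  tornheim_sum (fun n _ => u n) =
    (tri_sum (fun m _ => u m) +
     \esum_(n in [set n | (0 < n)%N]) ((u n)%:R / n%:R ^+ 3)%:E)%E.
Proof.
rewrite tri_sum_rows -esumD; last 2 first.
- by move=> n _; rewrite lee_fin mulr_ge0// divr_ge0// sumr_ge0.
- by move=> n _; rewrite lee_fin divr_ge0.
transitivity (\esum_(n in [set n | (0 < n)%N]) \esum_(k in [set k | (0 < k)%N])
    ((u n)%:R * (n%:R * k%:R * (n + k)%:R)^-1 : R)%:E)%E.
  rewrite esum_esum; last by move=> *; rewrite lee_fin mulr_ge0.
  by congr (esum _ _); apply/seteqP; split=> -[n k] /= /andP.
apply: eq_esum => n /= n0; have n0' : n%:R != 0 :> R by rewrite pnatr_eq0 -lt0n.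
transitivity (((u n)%:R / n%:R ^+ 2)%:E * \esum_(k in [set k | (0 < k)%N])
    (n%:R / (k%:R * (n + k)%:R) : R)%:E)%E.
  rewrite -ge0_esumZl; last 2 first.
  - by rewrite divr_ge0.
  - by move=> k _; rewrite lee_fin divr_ge0// mulr_ge0.
  apply: eq_esum => k /= k0; rewrite -EFinM; congr (_%:E).
  have k0' : k%:R != 0 :> R by rewrite pnatr_eq0 -lt0n.
  have : (n + k)%:R != 0 :> R by rewrite pnatr_eq0; lia.
  by rewrite natrD => nk0; field; rewrite nk0 k0' n0'.
(* The last term 1/n of the harmonic sum yields the cube; the rest is row n of the triangle. *)
rewrite (esum_inv_telescope n) -EFinM -EFinD big_nat_recr//=; congr (_%:E).
by field.
Qed.

(* The added term is chosen so that the left-hand side is nonincreasing in N. *)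
Lemma sum_harmonic_le (N : nat) :
  \sum_(1 <= n < N.+1) harmonic_number R n / n.+1%:R ^+ 2 +
    (harmonic_number R N.+1 + 1) / N.+1%:R <= 2.
Proof.
elim: N => [|N IH].
  by rewrite big_geq// /harmonic_number big_nat1 invr1 mulr1 add0r.
apply: le_trans IH; rewrite big_nat_recr//= -addrA lerD2l.
rewrite {2}/harmonic_number big_nat_recr//= -/(harmonic_number R N.+1).
set h := harmonic_number _ _.
have h0 : 0 <= h by exact: sumr_ge0.
have n0 : 0 < N.+1%:R :> R by rewrite ltr0n.
rewrite (_ : N.+2%:R = N.+1%:R + 1 :> R); last by rewrite natr1.
move: (N.+1%:R) n0 => x x0.
(* With x = N + 1 and h the harmonic number of index x, the decrease is exactly (h + 1)/(x (x +
   1)^2). *)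
rewrite -subr_ge0 (_ : _ - _ = h / (x * (x + 1) ^+ 2) + (x * (x + 1) ^+ 2)^-1).
  by rewrite addr_ge0 ?divr_ge0 ?invr_ge0// mulr_ge0// ?exprn_ge0; lra.
by field; rewrite !lt0r_neq0//; lra.
Qed.

(** Every weight is at most 1, and for weight 1 the partial sums stay below 2. Finiteness justifies
    the later cancellations. *)
Lemma tri_sum_lty w : (tri_sum w < +oo)%E.
Proof.
apply: (@le_lt_trans _ _ (tri_sum (fun _ _ => true))).
  apply: le_esum => p _; rewrite lee_fin ler_wpM2r ?invr_ge0 ?mulr_ge0//.
  by case: (w _ _).
rewrite (tri_sum_harmonic xpredT).
apply: (@le_lt_trans _ _ 2%:E); last exact: ltry.
have h0 n : 0 <= 1%:R * (harmonic_number R n / n.+1%:R ^+ 2).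
  by rewrite mulr_ge0// divr_ge0// sumr_ge0.
apply: lime_le; first by apply: is_cvg_nneseries => n _ _; rewrite lee_fin.
exists 1%N => // -[//|N] _ /=; rewrite sumEFin lee_fin.
apply: le_trans (sum_harmonic_le N); under eq_bigr do rewrite mul1r.
by rewrite lerDl divr_ge0// addr_ge0// sumr_ge0.
Qed.

Lemma tri_sum_fin w : tri_sum w \is a fin_num.
Proof. by rewrite ge0_fin_numE ?tri_sum_lty// tri_sum_ge0. Qed.

(** * Homogeneity under doubling of the indices *)

Lemma esum_even_cube :
  (\esum_(n in [set n | (0 < n)%N]) ((~~ odd n)%:R / n%:R ^+ 3)%:E =
   (8^-1)%:E * \esum_(n in [set n | (0 < n)%N]) (n%:R ^- 3 : R)%:E)%E.
Proof.
rewrite -ge0_esumZl ?invr_ge0//.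
transitivity (\esum_(n in [set n | (0 < n)%N] `&` [set n | ~~ odd n])
    (n%:R ^- 3 : R)%:E)%E.
  rewrite esum_mkcondr; apply: eq_esum => n _; rewrite mem_setE.
  by rewrite -topredE/=; case: (odd n); rewrite ?mul0r ?mul1r.
rewrite (reindex_esum [set n | (0 < n)%N] _ double); last first.
  split=> [n/=|n m _ _ /double_inj//|n/= [n0 ev]]; first by rewrite odd_double; lia.
  by exists n./2; [|rewrite even_halfK]; lia.
apply: eq_esum => n /= n0; rewrite -EFinM -mul2n natrM exprMn invfM.
by congr (_ * _)%:E; congr (_^-1); ring.
Qed.

Lemma tri_sum_even_even :
  tri_sum (fun m n => ~~ odd m && ~~ odd n) =
    ((8^-1)%:E * tri_sum (fun _ _ => true))%E.
Proof.
rewrite /tri_sum -ge0_esumZl ?invr_ge0//.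
set D := [set p : nat * nat | (1 <= p.2 < p.1)%N].
transitivity (\esum_(p in D `&` [set p | ~~ odd p.1 && ~~ odd p.2])
    ((p.1%:R ^+ 2 * p.2%:R ^+ 1)^-1 : R)%:E)%E.
  rewrite esum_mkcondr; apply: eq_esum => -[m n] _; rewrite mem_setE/=.
  by rewrite -topredE/=; case: (~~ _ && _); rewrite ?mul0r ?mul1r.
rewrite (reindex_esum D _ (fun p => (p.1.*2, p.2.*2))); last first.
  rewrite /D; split=> [[m n]/=|[m n] [m' n']/= _ _|[m n]/=].
  - by rewrite !odd_double; split=> //; lia.
  - by move=> [/double_inj-> /double_inj->].
  move=> [mn /andP[mev nev]]; exists (m./2, n./2); first by rewrite /D/=; lia.
  by rewrite /= !even_halfK.
apply: eq_esum => -[m n] _ /=; rewrite -EFinM -!mul2n !natrM mul1r -invfM.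
by congr (_^-1)%:E; ring.
Qed.

(** * Evaluations in terms of zeta(3) *)

(** Both evaluations of the Tornheim sum of weight 1 are compared, and one finite copy of the
    triangle sum is cancelled. *)
Lemma esum_cube_tri_sum :
  \esum_(n in [set n | (0 < n)%N]) (n%:R ^- 3 : R)%:E = tri_sum (fun _ _ => true).
Proof.
have := tornheim_sum_partial_fractions (fun _ _ => true).
rewrite (tornheim_sum_rows xpredT) => /(congr1 (fun x => x - tri_sum (fun _ _ => true))%E) /=.
rewrite addeAC subee ?tri_sum_fin// add0e addeK ?tri_sum_fin// => <-.
by apply: eq_esum => n _; rewrite mul1r.
Qed.

Lemma zeta3_tri_sum : (zeta (3 : R))%:E = tri_sum (fun _ _ => true).
Proof.
rewrite -[RHS]fineK ?tri_sum_fin//; congr (_%:E); apply/cvg_lim => //.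
under eq_fun do under eq_bigr do rewrite powR_invn//.
apply: cvg_sum_nneseries; first by move=> n _; rewrite invr_ge0.
rewrite fineK ?tri_sum_fin// -esum_cube_tri_sum esum_gt0_nneseries//.
Qed.

Lemma tri_sum_even :
  tri_sum (fun m _ => ~~ odd m) = (9 / 16 * zeta (3 : R))%:E.
Proof.
have parity : (tri_sum (fun m n => ~~ odd n) + tri_sum (fun m n => ~~ odd (m - n))
    + tri_sum (fun m _ => ~~ odd m) = tri_sum (fun _ _ => true) +
    (tri_sum (fun m n => ~~ odd m && ~~ odd n) +
     tri_sum (fun m n => ~~ odd m && ~~ odd n)))%E.
  (* The parity identity is applied in two steps, each with two weights per side; [m odd or n even]
     is the intermediate weight. *)
  rewrite (@tri_sumD _ _ (fun m n => odd m || ~~ odd n)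
                         (fun m n => ~~ odd m && ~~ odd n)); last first.
    by move=> m n /andP[_ /ltnW nm]; rewrite oddB//; case: odd; case: odd.
  rewrite addeAC [RHS]addeA; congr (_ + _)%E; apply: tri_sumD.
  by move=> m n _; case: odd; case: odd.
have := tornheim_sum_partial_fractions (fun n _ => ~~ odd n).
rewrite (tornheim_sum_rows (fun n => ~~ odd n)) esum_even_cube esum_cube_tri_sum.
move: parity; rewrite tri_sum_even_even -zeta3_tri_sum.
move: (tri_sum_fin (fun m _ => ~~ odd m)) (tri_sum_fin (fun m n => ~~ odd n))
  (tri_sum_fin (fun m n => ~~ odd (m - n))).
(* All sums are now real. With E the goal's sum and S the sum of the other two, S + E = (5/4)
   zeta(3) and E + zeta(3)/8 = S. *)
move=> /fineK<- /fineK<- /fineK<-; rewrite -!EFinM -!EFinD => -[e1] [e2].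
by congr (_%:E); lra.
Qed.

End double_sums.

(** * The plain and the alternating harmonic series *)

Theorem lemma3p4 (R : realType) :
  [/\ double_zeta R 2 1 =
        (\sum_(1 <= n <oo) (harmonic_number R n / (n.+1)%:R ^+ 2)%:E)%E,
      (\sum_(1 <= n <oo) (harmonic_number R n / (n.+1)%:R ^+ 2)%:E)%E =
        (zeta (3 : R))%:E
    & (fun N => \sum_(1 <= n < N)
         (-1) ^+ n * harmonic_number R n / (n.+1)%:R ^+ 2) @ \oo -->
        - (1 / 8) * zeta (3 : R)].
Proof.
have series_true : (\sum_(1 <= n <oo)
    (harmonic_number R n / n.+1%:R ^+ 2)%:E)%E = tri_sum R (fun _ _ => true).
  by rewrite (tri_sum_harmonic R xpredT); under [RHS]eq_eseriesr do rewrite mul1r.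
split; first by rewrite series_true double_zeta21E.
  by rewrite series_true zeta3_tri_sum.
have h0 n : 0 <= harmonic_number R n / n.+1%:R ^+ 2.
  by rewrite divr_ge0// sumr_ge0.
have cvg_all : (fun N => \sum_(1 <= n < N) harmonic_number R n / n.+1%:R ^+ 2)
    @ \oo --> zeta (3 : R).
  by apply: cvg_sum_nneseries => //; rewrite series_true zeta3_tri_sum.
have cvg_even : (fun N => \sum_(1 <= n < N)
    (~~ odd n.+1)%:R * (harmonic_number R n / n.+1%:R ^+ 2))
    @ \oo --> 9 / 16 * zeta (3 : R).
  apply: cvg_sum_nneseries => [n _|]; first by rewrite mulr_ge0.
  by rewrite -(tri_sum_harmonic R (fun m => ~~ odd m)) tri_sum_even.
rewrite (_ : - (1 / 8) * _ = zeta 3 - 2 * (9 / 16 * zeta (3 : R))); last by field.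
(* The sign is (-1)^n = 1 - 2 [n + 1 even]: the parity weight sits on m = n + 1, so it selects odd
   n. *)
rewrite (_ : (fun _ => _) = (fun N =>
  \sum_(1 <= n < N) harmonic_number R n / n.+1%:R ^+ 2 -
  2 * \sum_(1 <= n < N)
    (~~ odd n.+1)%:R * (harmonic_number R n / n.+1%:R ^+ 2))); last first.
  apply/funext => N; rewrite mulr_sumr -sumrB; apply: eq_bigr => n _.
  by rewrite /= negbK -signr_odd; case: odd; rewrite ?expr0 ?expr1/=; ring.
by apply: cvgB => //; apply: cvgMr.
Qed.
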